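(* Let $(A,\lhd_1,\lhd_2,\rhd_1,\rhd_2)$ be a pre-diassociative algebra, with sub-adjacent diassociative algebra $(A,\dashv_A,\vdash_A)$. Let $\{e_1,\dots,e_n\}$ be a basis of $A$ and $\{e_1^*,\dots,e_n^*\}$ its dual basis. Define $r:=\sum_{i=1}^n(e_i^*\otimes e_i+e_i\otimes e_i^* )$. Then $r$ is a symmetric solution of the diassociative Yang-Baxter equation (DYBE) in the semi-direct product diassociative algebra $A\oplus A^*$ of $(A,\dashv_A,\vdash_A)$ with its representation $(A^*,\ R^*_{\lhd_2}-R^*_{\rhd_2},\ L^*_{\rhd_1},\ R^*_{\lhd_2},\ L^*_{\rhd_1}-L^*_{\lhd_1})$. Furthermore, $r$ is nondegenerate, and the bilinear form $\omega_r$ on $A\oplus A^*$ induced by $r$ is given by $$\omega_r(x+a^*,y+b^* )=\langle a^*,y\rangle+\langle b^*,x\rangle,\qquad x,y\in A,\ a^*,b^*\in A^*.$$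
   Context: All vector spaces are finite-dimensional over a field $\mathbf{k}$ of characteristic $0$. A diassociative algebra is a triple $(A,\dashv_A,\vdash_A)$ consisting of a vector space $A$ and two bilinear operations such that for all $x,y,z\in A$ (subscripts omitted): $(x\dashv y)\dashv z=x\dashv(y\dashv z)=x\dashv(y\vdash z)$; $(x\vdash y)\dashv z=x\vdash(y\dashv z)$; $(x\vdash y)\vdash z=(x\dashv y)\vdash z=x\vdash(y\vdash z)$. Put $x\bullet_A y:=x\vdash_A y-x\dashv_A y$. A pre-diassociative algebra is a vector space $A$ with bilinear operations $\lhd_1,\lhd_2,\rhd_1,\rhd_2$ such that, writing $x\dashv y:=x\lhd_1y+x\lhd_2y$ and $x\vdash y:=x\rhd_1y+x\rhd_2y$, for all $x,y,z\in A$: $x\lhd_1(y\lhd_1z)=x\lhd_1(y\rhd_1z)=(x\dashv y)\lhd_1z$; $x\lhd_1(y\lhd_2z)=x\lhd_1(y\rhd_2z)=(x\lhd_1y)\lhd_2z$; $x\lhd_2(y\dashv z)=x\lhd_2(y\vdash z)=(x\lhd_2y)\lhd_2z$; $(x\vdash y)\lhd_1z=x\rhd_1(y\lhd_1z)$; $(x\rhd_1y)\lhd_2z=x\rhd_1(y\lhd_2z)$; $(x\rhd_2y)\lhd_2z=x\rhd_2(y\dashv z)$; $(x\dashv y)\rhd_1z=(x\vdash y)\rhd_1z=x\rhd_1(y\rhd_1z)$; $(x\lhd_1y)\rhd_2z=(x\rhd_1y)\rhd_2z=x\rhd_1(y\rhd_2z)$; $(x\lhd_2y)\rhd_2z=(x\rhd_2y)\rhd_2z=x\rhd_2(y\vdash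 z)$. Then $(A,\dashv_A,\vdash_A):=(A,\dashv,\vdash)$ is a diassociative algebra, called the sub-adjacent diassociative algebra. A representation of $(A,\dashv_A,\vdash_A)$ is a tuple $(V,\ell_{\dashv},r_{\dashv},\ell_{\vdash},r_{\vdash})$ of a vector space and linear maps $A\to\mathrm{End}(V)$ such that $A\oplus V$ with $(a+u)\dashv'(b+v)=a\dashv_A b+\ell_{\dashv}(a)v+r_{\dashv}(b)u$ and $(a+u)\vdash'(b+v)=a\vdash_A b+\ell_{\vdash}(a)v+r_{\vdash}(b)u$ is a diassociative algebra, called the semi-direct product diassociative algebra. It is known that $(A^*,R^*_{\lhd_2}-R^*_{\rhd_2},L^*_{\rhd_1},R^*_{\lhd_2},L^*_{\rhd_1}-L^*_{\lhd_1})$ is a representation of $(A,\dashv_A,\vdash_A)$. Here $L_\diamond(x)y=x\diamond y$, $R_\diamond(y)x=x\diamond y$, and for $\rho:A\to\mathrm{End}(A)$, $\langle\rho^*(x)a^*,y\rangle=\langle a^*,\rho(x)y\rangle$ (no sign). An element $r=\sum_i u_i\otimes v_i\in E\otimes E$ is a solution of the DYBE in a diassociative algebra $(E,\dashv,\vdash)$ (with $\bullet=\vdash-\dashv$) if $\sum_{i,j}\big(u_i\vdash u_j\otimes v_i\otimes v_j-u_i\otimes u_j\otimes v_i\dashv v_j-u_i\otimes u_j\bullet v_i\otimes v_j\big)=0$. It is symmetric if invariant under $u\otimes v\mapsto v\otimes u$. The element $r\in E\otimes E$ is identified with the linear map $r:E^*\to E$, $r(u^* )=\sum_i\langle u^*,u_i\rangle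 v_i$; $r$ is nondegenerate if this map is invertible, and then the induced bilinear form is $\omega_r(x,y)=\langle r^{-1}(x),y\rangle$ for $x,y\in E$. *)

(* Defs.v *)
From HB Require Import structures.
From mathcomp Require Import all_boot all_order all_algebra.
From mathcomp Require Import ring.
Set Implicit Arguments.
Unset Strict Implicit.
Unset Printing Implicit Defensive.
Import GRing.Theory.
Local Open Scope ring_scope.

(* [linfun f] is unspecified unless [f] is linear; each [linfun] below comes
   with a lemma, proved from [linfunE], computing its values. *)
Lemma linfunE (k : fieldType) (U V : vectType k) (f : U -> V) :
  linear f -> forall x, linfun f x = f x.
Proof.
move=> lf x.
pose g : {linear U -> V} := HB.pack f (GRing.isLinear.Build k U V *:%R f lf).
exact: (lfunE g x).
Qed.

Section LinearAlgebra.
Variable k : fieldType.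
Implicit Types U V W : vectType k.

Definition dual U : vectType k := 'Hom(U, k^o).

Definition pairing U (a : dual U) (x : U) : k := a x.

(* Bilinear maps U x V -> W, in curried form. *)
Definition bilin U V W : vectType k := 'Hom(U, 'Hom(V, W)).

Lemma bilinDl U V W (f : bilin U V W) x y z : f (x + y) z = f x z + f y z.
Proof. by rewrite linearD add_lfunE. Qed.

Lemma bilinDr U V W (f : bilin U V W) x y z : f x (y + z) = f x y + f x z.
Proof. by rewrite linearD. Qed.

Definition bilin_flip U V W (f : bilin U V W) : bilin V U W :=
  linfun (fun y : V => linfun (fun x : U => f x y)).

Lemma bilin_flipE U V W (f : bilin U V W) x y : bilin_flip f y x = f x y.
Proof.
have L v : linear (fun x : U => f x v).
  by move=> a u w; rewrite linearP add_lfunE scale_lfunE.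
rewrite /bilin_flip linfunE ?linfunE // => a u w; apply/lfunP=> z.
by rewrite add_lfunE scale_lfunE !linfunE // linearP.
Qed.

(* The transpose, without sign: <rho^*(x) a, y> = <a, rho(x) y>. *)
Definition transpose_action U V (rho : 'Hom(U, 'End(V))) :
    'Hom(U, 'End(dual V)) :=
  linfun (fun x : U => linfun (fun a : dual V => (a \o rho x)%VF : dual V)).

Lemma transpose_actionE U V (rho : 'Hom(U, 'End(V))) x (a : dual V) y :
  pairing (transpose_action rho x a) y = pairing a (rho x y).
Proof.
have L v : linear (fun a : dual V => (a \o rho v)%VF : dual V).
  by move=> c u w; rewrite comp_lfunDl comp_lfunZl.
have L' : linear (fun x : U => linfun (fun a : dual V => (a \o rho x)%VF : dual V)).
  move=> c u w; apply/lfunP=> z; rewrite add_lfunE scale_lfunE !linfunE //.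
  by rewrite linearP comp_lfunDr comp_lfunZr.
by rewrite /pairing /transpose_action linfunE // linfunE // comp_lfunE.
Qed.

(* The tensor product of two finite-dimensional spaces, modelled by the
   canonical isomorphism U (x) V = Hom(U^*, V) sending u (x) v to
   u^* |-> <u^*, u> v.  [tensor_universal] is its universal property. *)
Definition tensor U V : vectType k := 'Hom(dual U, V).

Definition tens U V (u : U) (v : V) : tensor U V :=
  linfun (fun a : dual U => pairing a u *: v).

Lemma tensE U V (u : U) (v : V) (a : dual U) : tens u v a = pairing a u *: v.
Proof.
rewrite linfunE // => c b b'.
by rewrite /pairing add_lfunE scale_lfunE scalerDl -scalerA.
Qed.

Lemma tens_linearl U V (v : V) : linear (fun u : U => tens u v).
Proof.
move=> c u w; apply/lfunP=> a; rewrite add_lfunE scale_lfunE !tensE.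
by rewrite /pairing linearP scalerDl scalerA.
Qed.

Lemma tens_linearr U V (u : U) : linear (fun v : V => tens u v).
Proof.
move=> c v w; apply/lfunP=> a; rewrite add_lfunE scale_lfunE !tensE.
by rewrite scalerDr !scalerA mulrC.
Qed.

Definition dual_basis U n (e : n.-tuple U) (i : 'I_n) : dual U :=
  linfun (coord e i : U -> k^o).

Lemma dual_basisE U n (e : n.-tuple U) i x :
  pairing (dual_basis e i) x = coord e i x.
Proof. by rewrite /pairing linfunE // => c u v; rewrite linearP. Qed.

Lemma dual_basisP U n (e : n.-tuple U) i j : basis_of fullv e ->
  pairing (dual_basis e i) (tnth e j) = (i == j)%:R.
Proof.
move=> /andP[_ fe]; rewrite dual_basisE (tnth_nth 0) coord_free //.
by rewrite eq_sym.
Qed.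

Lemma pairing_ext U (x y : U) :
  (forall a : dual U, pairing a x = pairing a y) -> x = y.
Proof.
move=> E; have be := vbasisP (fullv : {vspace U}).
rewrite (coord_basis be (memvf x)) (coord_basis be (memvf y)).
by apply: eq_bigr => i _; rewrite -!dual_basisE E.
Qed.

Lemma pairingE U :
  ((forall (a : dual U) x y, (pairing a (x + y) = pairing a x + pairing a y)%R) *
   (forall (a : dual U) x, (pairing a (- x) = - pairing a x)%R) *
   (forall (a b : dual U) x, (pairing (a + b) x = pairing a x + pairing b x)%R) *
   (forall (a : dual U) x, (pairing (- a) x = - pairing a x)%R))%type.
Proof.
rewrite /pairing; do ![split] => *.
- by rewrite linearD.
- by rewrite linearN.
- by rewrite add_lfunE.
- by rewrite opp_lfunE.
Qed.

Lemma dual_ext U (a b : dual U) :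
  (forall x, pairing a x = pairing b x) -> a = b.
Proof. by move=> E; apply/lfunP => x; apply: E. Qed.

Lemma tensor_decomp U V (t : tensor U V) n (e : n.-tuple U) :
  basis_of fullv e -> t = \sum_i tens (tnth e i) (t (dual_basis e i)).
Proof.
move=> be; apply/lfunP=> a; rewrite sum_lfunE.
have -> : a = \sum_i pairing a (tnth e i) *: dual_basis e i.
  apply/lfunP=> x; rewrite sum_lfunE.
  rewrite {1}(coord_basis be (memvf x)) linear_sum.
  apply: eq_bigr => i _; rewrite scale_lfunE linearZ.
  rewrite -[dual_basis e i x]/(pairing (dual_basis e i) x) dual_basisE.
  by rewrite -tnth_nth [RHS]mulrC.
rewrite linear_sum; apply: eq_bigr => i _; rewrite tensE linearZ /=.
congr (_ *: _); rewrite /pairing sum_lfunE (bigD1 i) //= scale_lfunE.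
rewrite -[dual_basis e i _]/(pairing (dual_basis e i) (tnth e i)).
rewrite dual_basisP // eqxx big1 ?addr0 ?[RHS]mulr1 // => j nji.
rewrite scale_lfunE -[dual_basis e j _]/(pairing (dual_basis e j) (tnth e i)).
by rewrite dual_basisP // (negbTE nji) [LHS]mulr0.
Qed.

Definition tensor_lift U V W (f : bilin U V W) : 'Hom(tensor U V, W) :=
  let e := vbasis (fullv : {vspace U}) in
  linfun (fun t : tensor U V => \sum_i f (tnth e i) (t (dual_basis e i))).

Lemma tensor_liftE U V W (f : bilin U V W) u v :
  tensor_lift f (tens u v) = f u v.
Proof.
rewrite /tensor_lift linfunE => [|c s t]; last first.
  rewrite scaler_sumr -big_split; apply: eq_bigr => i _ /=.
  by rewrite add_lfunE scale_lfunE linearP.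
rewrite {2}(coord_basis (vbasisP fullv) (memvf u)) linear_sum sum_lfunE.
apply: eq_bigr => i _; rewrite tensE dual_basisE linearZ.
by rewrite linearZ scale_lfunE -tnth_nth.
Qed.

Lemma tensor_universal U V W (f : bilin U V W) :
  exists! g : 'Hom(tensor U V, W), forall u v, g (tens u v) = f u v.
Proof.
exists (tensor_lift f); split=> [u v|g gP]; first exact: tensor_liftE.
apply/lfunP=> t; rewrite (tensor_decomp t (vbasisP fullv)) !linear_sum.
by apply: eq_bigr => i _ /=; rewrite tensor_liftE gP.
Qed.

Definition tens_bilin U V : bilin U V (tensor U V) :=
  linfun (fun u : U => linfun (fun v : V => tens u v)).

Lemma tens_bilinE U V (u : U) (v : V) : tens_bilin U V u v = tens u v.
Proof.
rewrite /tens_bilin linfunE ?linfunE //; first exact: tens_linearr.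
move=> c x y; apply/lfunP=> z.
rewrite add_lfunE scale_lfunE !linfunE; try exact: tens_linearr.
exact: tens_linearl.
Qed.

Definition tensor_swap U V : 'Hom(tensor U V, tensor V U) :=
  tensor_lift (bilin_flip (tens_bilin V U)).

Lemma tensor_swapE U V (u : U) (v : V) :
  tensor_swap U V (tens u v) = tens v u.
Proof. by rewrite tensor_liftE bilin_flipE tens_bilinE. Qed.

(* r(u^* ) = sum_i <u^*, u_i> v_i; in the model above this is r itself. *)
Definition tensor_map U V (r : tensor U V) : 'Hom(dual U, V) := r.

Lemma tensor_mapE U V n (u : 'I_n -> U) (v : 'I_n -> V) (a : dual U) :
  tensor_map (\sum_i tens (u i) (v i)) a = \sum_i pairing a (u i) *: v i.
Proof. by rewrite /tensor_map sum_lfunE; apply: eq_bigr => i _; rewrite tensE. Qed.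

Definition symmetric_tensor U (r : tensor U U) : Prop := tensor_swap U U r = r.

Definition nondegenerate_tensor U (r : tensor U U) : Prop := bijective (tensor_map r).

(* [_^-1] is the inverse map whenever [r] is nondegenerate. *)
Definition induced_form U (r : tensor U U) (x y : U) : k :=
  pairing ((tensor_map r)^-1%VF x : dual U) y.

End LinearAlgebra.

Section Diassociative.
Variable k : fieldType.
Implicit Types A E V : vectType k.

Definition binop A : vectType k := bilin A A A.

Definition Lmul A (m : binop A) : 'Hom(A, 'End(A)) := m.
Definition Rmul A (m : binop A) : 'Hom(A, 'End(A)) := bilin_flip m.

Lemma LmulE A (m : binop A) x y : Lmul m x y = m x y.
Proof. by []. Qed.

Lemma RmulE A (m : binop A) x y : Rmul m y x = m x y.
Proof. exact: bilin_flipE. Qed.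

(* [dl] is the operation "-|" and [dr] is the operation "|-". *)
Definition diassociative A (dl dr : binop A) : Prop :=
  forall x y z : A,
  [/\ dl (dl x y) z = dl x (dl y z) /\ dl x (dl y z) = dl x (dr y z),
      dl (dr x y) z = dr x (dl y z)
    & dr (dr x y) z = dr (dl x y) z /\ dr (dl x y) z = dr x (dr y z)].

Record diassAlgebra A := DiassAlgebra {
  dleft : binop A;
  dright : binop A;
  diassP : diassociative dleft dright }.

Definition dbullet A (D : diassAlgebra A) : binop A := dright D - dleft D.

(* [l1], [l2] are the two "left triangles", [r1], [r2] the two "right
   triangles". *)
Definition prediassociative A (l1 l2 r1 r2 : binop A) : Prop :=
  let dl : binop A := l1 + l2 in
  let dr : binop A := r1 + r2 in
  (forall x y z : A,
     l1 x (l1 y z) = l1 x (r1 y z) /\ l1 x (r1 y z) = l1 (dl x y) z) /\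
  (forall x y z : A,
     l1 x (l2 y z) = l1 x (r2 y z) /\ l1 x (r2 y z) = l2 (l1 x y) z) /\
  (forall x y z : A,
     l2 x (dl y z) = l2 x (dr y z) /\ l2 x (dr y z) = l2 (l2 x y) z) /\
  (forall x y z : A, l1 (dr x y) z = r1 x (l1 y z)) /\
  (forall x y z : A, l2 (r1 x y) z = r1 x (l2 y z)) /\
  (forall x y z : A, l2 (r2 x y) z = r2 x (dl y z)) /\
  (forall x y z : A,
     r1 (dl x y) z = r1 (dr x y) z /\ r1 (dr x y) z = r1 x (r1 y z)) /\
  (forall x y z : A,
     r2 (l1 x y) z = r2 (r1 x y) z /\ r2 (r1 x y) z = r1 x (r2 y z)) /\
  (forall x y z : A,
     r2 (l2 x y) z = r2 (r2 x y) z /\ r2 (r2 x y) z = r2 x (dr y z)).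

Record prediassAlgebra A := PrediassAlgebra {
  lhd1 : binop A;
  lhd2 : binop A;
  rhd1 : binop A;
  rhd2 : binop A;
  prediassP : prediassociative lhd1 lhd2 rhd1 rhd2 }.

(* The axioms, solved for one degree-3 monomial each. *)
Lemma prediass_rules A (P : prediassAlgebra A) :
  let l1 := lhd1 P in let l2 := lhd2 P in
  let r1 := rhd1 P in let r2 := rhd2 P in
  ((forall x y z, (l1 x (r1 y z) = l1 x (l1 y z))%R) *
   (forall x y z, (l1 (l2 x y) z = l1 x (l1 y z) - l1 (l1 x y) z)%R) *
   (forall x y z, (l1 x (r2 y z) = l1 x (l2 y z))%R) *
   (forall x y z, (l2 (l1 x y) z = l1 x (l2 y z))%R) *
   (forall x y z, (l2 (l2 x y) z = l2 x (l1 y z) + l2 x (l2 y z))%R) *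
   (forall x y z, (l2 x (r2 y z)
      = l2 x (l1 y z) + l2 x (l2 y z) - l2 x (r1 y z))%R) *
   (forall x y z, (l1 (r2 x y) z = r1 x (l1 y z) - l1 (r1 x y) z)%R) *
   (forall x y z, (l2 (r1 x y) z = r1 x (l2 y z))%R) *
   (forall x y z, (l2 (r2 x y) z = r2 x (l1 y z) + r2 x (l2 y z))%R) *
   (forall x y z, (r1 (l2 x y) z = r1 x (r1 y z) - r1 (l1 x y) z)%R) *
   (forall x y z, (r1 (r2 x y) z = r1 x (r1 y z) - r1 (r1 x y) z)%R) *
   (forall x y z, (r2 (l1 x y) z = r1 x (r2 y z))%R) *
   (forall x y z, (r2 (r1 x y) z = r1 x (r2 y z))%R) *
   (forall x y z, (r2 (l2 x y) z = r2 x (r1 y z) + r2 x (r2 y z))%R) *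
   (forall x y z, (r2 (r2 x y) z = r2 x (r1 y z) + r2 x (r2 y z))%R))%type.
Proof.
case: P => l1 l2 r1 r2 /=.
move=> [H1 [H2 [H3 [H4 [H5 [H6 [H7 [H8 H9]]]]]]]].
do ![split] => x y z.
- by case: (H1 x y z).
- by case: (H1 x y z) => -> ->; rewrite !add_lfunE bilinDl addrAC subrr add0r.
- by case: (H2 x y z).
- by case: (H2 x y z) => -> ->.
- by case: (H3 x y z) => E1 E2; rewrite -E2 -E1 !add_lfunE linearD.
- case: (H3 x y z) => E1 _; move: E1.
  by rewrite !add_lfunE !linearD /= => ->; rewrite addrAC subrr add0r.
- by rewrite -H4 !add_lfunE bilinDl addrAC subrr add0r.
- exact: H5.
- by rewrite H6 !add_lfunE linearD.
- case: (H7 x y z) => E1 E2.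
  by rewrite -E2 -E1 !add_lfunE bilinDl addrAC subrr add0r.
- case: (H7 x y z) => E1 E2.
  by rewrite -E2 !add_lfunE bilinDl addrAC subrr add0r.
- by case: (H8 x y z) => -> ->.
- by case: (H8 x y z).
- by case: (H9 x y z) => -> ->; rewrite !add_lfunE linearD.
- by case: (H9 x y z) => _ ->; rewrite !add_lfunE linearD.
Qed.

Lemma subadjacent_diass A (P : prediassAlgebra A) :
  diassociative (lhd1 P + lhd2 P) (rhd1 P + rhd2 P).
Proof.
move=> x y z; do ![split]; apply: pairing_ext => a;
rewrite !add_lfunE !(bilinDl, bilinDr) !(prediass_rules P) !pairingE; ring.
Qed.



Definition subadjacent A (P : prediassAlgebra A) : diassAlgebra A :=
  DiassAlgebra (subadjacent_diass P).

(* (a + u, b + v) |-> m(a, b) + l(a) v + r(b) u on the direct sum A (+) V. *)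
Definition semidirect_op A V (m : binop A) (l r : 'Hom(A, 'End(V))) :
    binop (A * V)%type :=
  linfun (fun p : A * V => linfun (fun q : A * V =>
    (m p.1 q.1, l p.1 q.2 + r q.1 p.2) : A * V)).

Lemma semidirect_opE A V (m : binop A) (l r : 'Hom(A, 'End(V))) p q :
  semidirect_op m l r p q = (m p.1 q.1, l p.1 q.2 + r q.1 p.2).
Proof.
have L p' : linear (fun q : A * V =>
    (m p'.1 q.1, l p'.1 q.2 + r q.1 p'.2) : A * V).
  move=> c [a u] [b v]; congr (_, _) => /=; first by rewrite linearP.
  rewrite !linearP add_lfunE scale_lfunE scalerDr.
  by rewrite addrACA.
rewrite /semidirect_op linfunE; first by rewrite linfunE.
move=> c [a u] [b v]; apply/lfunP=> -[d w].
rewrite add_lfunE scale_lfunE !linfunE //.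
congr (_, _) => /=; first by rewrite linearP add_lfunE scale_lfunE.
rewrite !linearP add_lfunE scale_lfunE scalerDr.
by rewrite addrACA.
Qed.

Record representation A (D : diassAlgebra A) V := Representation {
  rep_ll : 'Hom(A, 'End(V));
  rep_rl : 'Hom(A, 'End(V));
  rep_lr : 'Hom(A, 'End(V));
  rep_rr : 'Hom(A, 'End(V));
  repP : diassociative (semidirect_op (dleft D) rep_ll rep_rl)
                       (semidirect_op (dright D) rep_lr rep_rr) }.

Definition semidirect A (D : diassAlgebra A) V (M : representation D V) :
    diassAlgebra (A * V)%type :=
  DiassAlgebra (repP M).

Lemma dual_rep_diass A (P : prediassAlgebra A) :
  diassociative
    (semidirect_op (dleft (subadjacent P))
       (transpose_action (Rmul (lhd2 P)) - transpose_action (Rmul (rhd2 P)))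
       (transpose_action (Lmul (rhd1 P))))
    (semidirect_op (dright (subadjacent P))
       (transpose_action (Rmul (lhd2 P)))
       (transpose_action (Lmul (rhd1 P)) - transpose_action (Lmul (lhd1 P)))).
Proof.
move=> [x a] [y b] [z c]; rewrite !semidirect_opE /=.
have [[A1 A2] A3 [A4 A5]] := subadjacent_diass P x y z.
do ![split]; congr (_, _) => //; apply: dual_ext => w.
all: rewrite /Lmul !(add_lfunE, opp_lfunE, pairingE, transpose_actionE, RmulE).
all: rewrite !(bilinDl, bilinDr, pairingE) !(prediass_rules P) !pairingE; ring.
Qed.

Definition dual_rep A (P : prediassAlgebra A) :
    representation (subadjacent P) (dual A) :=
  Representation (dual_rep_diass P).

(* The left-hand side of the DYBE for r = sum_i u_i (x) v_i. *)
Definition DYBE_lhs E (D : diassAlgebra E) m (u v : 'I_m -> E) :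
    tensor E (tensor E E) :=
  \sum_i \sum_j
    (tens (dright D (u i) (u j)) (tens (v i) (v j))
     - tens (u i) (tens (u j) (dleft D (v i) (v j)))
     - tens (u i) (tens (dbullet D (u j) (v i)) (v j))).

Lemma DYBE_lhsE E (D : diassAlgebra E) m (u v : 'I_m -> E) (a b : dual E) :
  let r := \sum_i tens (u i) (v i) in
  (DYBE_lhs D u v a : tensor E E) b =
    tensor_map r (a \o dright D (tensor_map (tensor_swap E E r) b))%VF
    - dleft D (tensor_map r a) (tensor_map r b)
    - tensor_map r (b \o Rmul (dbullet D) (tensor_map r a))%VF.
Proof.
set r := \sum_i _ => /=.
have rE c : tensor_map r c = \sum_i pairing c (u i) *: v i.
  exact: tensor_mapE.
have rtE c : tensor_map (tensor_swap E E r) c = \sum_i pairing c (v i) *: u i.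
  rewrite -tensor_mapE /r linear_sum; congr (tensor_map _ c).
  by apply: eq_bigr => i _ /=; rewrite tensor_swapE.
have -> : (DYBE_lhs D u v a : tensor E E) b = \sum_i \sum_j
    ((pairing a (dright D (u i) (u j)) * pairing b (v i)) *: v j
     - (pairing a (u i) * pairing b (u j)) *: dleft D (v i) (v j)
     - (pairing a (u i) * pairing b (dbullet D (u j) (v i))) *: v j).
  rewrite /DYBE_lhs !sum_lfunE; apply: eq_bigr => i _.
  rewrite !sum_lfunE; apply: eq_bigr => j _.
  by rewrite !(add_lfunE, opp_lfunE, tensE, scale_lfunE, scalerA).
rewrite exchange_big /=.
under eq_bigr do rewrite !sumrB; rewrite !sumrB; congr (_ - _ - _).
- rewrite rE; apply: eq_bigr => j _; rewrite -scaler_suml; congr (_ *: _).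
  rewrite /pairing comp_lfunE rtE !linear_sum sum_lfunE linear_sum.
  by apply: eq_bigr => i _; rewrite /= !linearZ scale_lfunE linearZ /= mulrC.
- rewrite (rE b) linear_sum; apply: eq_bigr => j _.
  rewrite linearZ (rE a) /= linear_sum sum_lfunE scaler_sumr.
  by apply: eq_bigr => i _; rewrite linearZ scale_lfunE scalerA mulrC.
- rewrite (rE (_ \o _)%VF); apply: eq_bigr => j _; rewrite -scaler_suml.
  congr (_ *: _); rewrite /pairing comp_lfunE RmulE (rE a) !linear_sum.
  by apply: eq_bigr => i _; rewrite /= !linearZ.
Qed.

(* The condition depends only on the tensor [r], by [DYBE_indep], and [r]
   always has an expression sum_i u_i (x) v_i, by [tensor_decomp]. *)
Lemma DYBE_indep E (D : diassAlgebra E) m (u v : 'I_m -> E)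
    m' (u' v' : 'I_m' -> E) :
  \sum_i tens (u i) (v i) = \sum_i tens (u' i) (v' i) ->
  DYBE_lhs D u v = DYBE_lhs D u' v'.
Proof.
by move=> e; apply/lfunP => a; apply/lfunP => b; rewrite !DYBE_lhsE e.
Qed.

Definition DYBE_solution E (D : diassAlgebra E) (r : tensor E E) : Prop :=
  forall (m : nat) (u v : 'I_m -> E),
    r = \sum_i tens (u i) (v i) -> DYBE_lhs D u v = 0.

End Diassociative.

(* Main.v *)
(** Viewed as a map [E^* -> E] with [E = A (+) A^*], the tensor [r] is the
    inverse of the map induced by the evaluation form
    [B(x + a, y + b) = a y + b x]; this gives symmetry, nondegeneracy and the
    induced form at once.  Writing functionals as [B(X, -)] and [B(Y, -)], the
    DYBE becomes the identity [B(X, Y |- w) = B(X -| Y, w) + B(Y, w * X)] with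
    [w * X = w |- X - w -| X].  Once the transposes in the dual representation
    are unfolded, both sides agree term by term. *)
Require Import Defs.
From mathcomp Require Import all_boot all_order all_algebra.
From mathcomp Require Import ring.
Set Implicit Arguments.
Unset Strict Implicit.
Unset Printing Implicit Defensive.
Import GRing.Theory.
Local Open Scope ring_scope.

Section EvaluationForm.
Variables (k : fieldType) (A : vectType k).
Local Notation E := (A * dual A)%type.

Definition eval_form (p q : E) : k := pairing p.2 q.1 + pairing q.2 p.1.

Definition eval_dual (p : E) : dual E := linfun (eval_form p : E -> k^o).

Lemma eval_dualE p q : pairing (eval_dual p) q = eval_form p q.
Proof.
rewrite /pairing linfunE // => c [x a] [y b].
rewrite /eval_form /pairing /= linearP add_lfunE scale_lfunE /=.
by rewrite scalerDr addrACA.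
Qed.

Lemma eval_formDl p q w : eval_form (p + q) w = eval_form p w + eval_form q w.
Proof. by rewrite /eval_form /pairing /= linearD add_lfunE addrACA. Qed.

(** Nondegeneracy of the evaluation form: testing against [(0, c)] recovers the [A]-component,
    testing against [(z, 0)] the dual one. *)
Lemma eval_form_inj p q : (forall w, eval_form p w = eval_form q w) -> p = q.
Proof.
case: p q => [x a] [y b] Epq; congr (_, _).
  apply: pairing_ext => c; have := Epq (0, c).
  by rewrite /eval_form /pairing /= !linear0 !add0r.
apply: dual_ext => z; have := Epq (z, 0).
by rewrite /eval_form /pairing /= !zero_lfunE !addr0.
Qed.

Variables (n : nat) (e : n.-tuple A).

Definition canonical_tensor : tensor E E :=
  \sum_(i < n) (tens (0, dual_basis e i) (tnth e i, 0)
                + tens (tnth e i, 0) (0, dual_basis e i)).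

Lemma canonical_tensor_sym : symmetric_tensor canonical_tensor.
Proof.
rewrite /symmetric_tensor /canonical_tensor linear_sum.
by apply: eq_bigr => i _; rewrite linearD /= !tensor_swapE addrC.
Qed.

Lemma dual_basis_decomp (a : dual A) : basis_of fullv e ->
  a = \sum_i pairing a (tnth e i) *: dual_basis e i.
Proof.
move=> he; apply: dual_ext => x.
rewrite {1}(coord_basis he (memvf x)) /pairing linear_sum sum_lfunE.
apply: eq_bigr => i _; rewrite linearZ scale_lfunE -tnth_nth.
by rewrite -[dual_basis e i x]/(pairing _ x) dual_basisE [LHS]mulrC.
Qed.

(** A tensor is encoded as a map [dual E -> E]: the first family of summands fills the
    [A]-component, the second the dual one. *)
Lemma canonical_tensorE (c : dual E) : canonical_tensor c =
  (\sum_i pairing c (0, dual_basis e i) *: tnth e i,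
   \sum_i pairing c (tnth e i, 0) *: dual_basis e i).
Proof.
rewrite /canonical_tensor sum_lfunE.
under eq_bigr do rewrite add_lfunE !tensE.
rewrite [LHS]surjective_pairing !raddf_sum /=.
congr (_, _); apply: eq_bigr => i _ /=.
  by rewrite scaler0 addr0.
by rewrite scaler0 add0r.
Qed.

Hypothesis he : basis_of fullv e.

Lemma eval_form_canonical (c : dual E) w :
  eval_form (canonical_tensor c) w = pairing c w.
Proof.
case: w => y b; rewrite canonical_tensorE /eval_form /=.
have -> : (y, b) = (y, 0) + (0, b) :> E by congr (_, _); rewrite ?addr0 ?add0r.
rewrite /pairing [RHS]linearD; congr (_ + _).
  rewrite sum_lfunE {2}(coord_basis he (memvf y)).
  have -> : (\sum_i coord e i y *: e`_i, 0) =
            \sum_i coord e i y *: (tnth e i, 0) :> E.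
    rewrite [RHS]surjective_pairing !raddf_sum /=.
    congr (_, _); last by rewrite big1 // => i _; rewrite scaler0.
    by apply: eq_bigr => i _; rewrite -tnth_nth.
  rewrite linear_sum; apply: eq_bigr => i _; rewrite scale_lfunE linearZ.
  by rewrite -[dual_basis e i y]/(pairing _ y) dual_basisE [LHS]mulrC.
rewrite linear_sum {2}(dual_basis_decomp b he).
have -> : (0, \sum_i pairing b (tnth e i) *: dual_basis e i) =
          \sum_i pairing b (tnth e i) *: (0, dual_basis e i) :> E.
  rewrite [RHS]surjective_pairing !raddf_sum /=.
  by congr (_, _); rewrite big1 // => i _; rewrite scaler0.
rewrite linear_sum; apply: eq_bigr => i _; rewrite !linearZ.
exact: mulrC.
Qed.

Lemma canonical_tensorK : cancel (tensor_map canonical_tensor) eval_dual.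
Proof.
by move=> c; apply: dual_ext => w; rewrite eval_dualE eval_form_canonical.
Qed.

Lemma eval_dualK : cancel eval_dual (tensor_map canonical_tensor).
Proof.
move=> p; apply: eval_form_inj => w.
by rewrite eval_form_canonical eval_dualE.
Qed.

Lemma canonical_tensor_nondegenerate : nondegenerate_tensor canonical_tensor.
Proof. by exists eval_dual; [exact: canonical_tensorK | exact: eval_dualK]. Qed.

Lemma induced_form_canonical p q :
  induced_form canonical_tensor p q = eval_form p q.
Proof.
rewrite /induced_form -eval_dualE; congr pairing.
(* With [p] written as the image of [eval_dual p], the inverse cancels once the kernel is known to
   be trivial. *)
rewrite -{1}[p]eval_dualK lker0_lfunK //.
by apply/lker0P; exact: can_inj canonical_tensorK.
Qed.

End EvaluationForm.

(** On the right, the two summands of [y |- z] paired with [a] come from different terms; the [lhd1]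
    terms paired with [c] cancel, as do the [lhd2] and [rhd2] terms paired with [b]. *)
Lemma eval_form_dual_rep (k : fieldType) (A : vectType k)
    (P : prediassAlgebra A) (X Y w : A * dual A) :
  let D := semidirect (dual_rep P) in
  eval_form X (dright D Y w)
  = eval_form (dleft D X Y) w + eval_form Y (dbullet D w X).
Proof.
case: X Y w => [x a] [y b] [z c].
rewrite /= /dbullet /= !(add_lfunE, opp_lfunE) !semidirect_opE /eval_form /=.
rewrite /Lmul !(add_lfunE, opp_lfunE, pairingE, transpose_actionE, RmulE).
ring.
Qed.

Lemma canonical_tensor_DYBE (k : fieldType) (A : vectType k)
    (P : prediassAlgebra A) (n : nat) (e : n.-tuple A) :
  basis_of fullv e ->
  DYBE_solution (semidirect (dual_rep P)) (canonical_tensor e).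
Proof.
move=> he m u v Er; set D := semidirect _.
apply/lfunP => a; apply/lfunP => b.
(* Symmetry removes the swap in the first term, so only one map [dual E -> E] remains. *)
rewrite DYBE_lhsE -Er (canonical_tensor_sym e) !zero_lfunE.
set X := tensor_map _ a; set Y := tensor_map _ b.
apply/eqP; rewrite subr_eq0 subr_eq; apply/eqP.
apply: eval_form_inj => w; rewrite eval_formDl !eval_form_canonical //.
rewrite /pairing !comp_lfunE RmulE -/(pairing a _) -/(pairing b _).
(* Here [a] and [b] become the functionals [eval_form X] and [eval_form Y]. *)
rewrite -!(eval_form_canonical he) addrC.
exact: eval_form_dual_rep.
Qed.

Theorem theorem4p12 (k : fieldType) (hk : [pchar k] =i pred0)
    (A : vectType k) (P : prediassAlgebra A)
    (n : nat) (e : n.-tuple A) (he : basis_of fullv e) :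
  let r : tensor (A * dual A)%type (A * dual A)%type :=
    \sum_(i < n) (tens (0, dual_basis e i) (tnth e i, 0)
                  + tens (tnth e i, 0) (0, dual_basis e i)) in
  [/\ symmetric_tensor r,
      DYBE_solution (semidirect (dual_rep P)) r,
      nondegenerate_tensor r
    & forall (x y : A) (a b : dual A),
        induced_form r (x, a) (y, b) = pairing a y + pairing b x].
Proof.
move=> r; split; first exact: canonical_tensor_sym.
- exact: canonical_tensor_DYBE.
- exact: canonical_tensor_nondegenerate.
- by move=> x y a b; exact: induced_form_canonical.
Qed.
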